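(* Let $(X,d,\nu)$ be a metric measure space with $\nu(X)=+\infty$. Let $f:[0,\infty)\to[0,\infty)$ be a convex increasing function with $f(0)=0$. Assume that there exists $C_{f,A}>0$ such that $$\nu(B(x,r))\le C_{f,A}f(r)\qquad\forall\, x\in X,\ r>0$$ (we say that $\nu$ is upper $f$-Ahlfors regular). Furthermore, assume that the map $r\mapsto\nu(B(x,r))$ is continuous for all $x\in X$, and that the limit $$\mathrm{AVR}_f=\lim_{r\to\infty}\frac{\nu(B(x_0,r))}{f(r)}$$ is well-defined for some (equivalently: all) $x_0\in X$ and $\mathrm{AVR}_f\in(0,+\infty)$. Then there exist constants $c_1,c_2,c_3>0$ such that for all $p\in[1,\infty)$ and $u\in L^p(X,\nu)$ we have $$c_1\|u\|_{L^p(X,\nu)}^p\le \bigg[\frac{u(x)-u(y)}{f(d(x,y))^{\frac 1p}}\bigg]^p_{L^p_w(X\times X,\nu\otimes\nu)}\le c_2\|u\|_{L^p(X,\nu)}^p .$$ Moreover, the lower bound can be improved in the following way: if we denote $$E_\lambda^f=\bigg\{(x,y)\in X\times X:\ \frac{|u(x)-u(y)|}{f(d(x,y))^{\frac 1p}}\ge\lambda\bigg\},$$ we have $$\lim_{\lambda\to0^+}\lambda^p(\nu\otimes\nu)(E_\lambda^f)=c_3\|u\|_{L^p(X,\nu)}^p .$$ We may take $c_1=c_3=2\cdot\mathrm{AVR}_f$ and $c_2=2^{p+1}C_{f,A}$.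
   Context: A metric measure space is a triple $(X,d,\nu)$, where $(X,d)$ is a complete and separable metric space and $\nu$ is a nonzero non-negative Borel measure on $X$ that is finite on bounded sets. $B(x,r)$ denotes the ball with center $x$ and radius $r$ in the metric $d$. Functions $u$ are real-valued. For a measure space $(Z,\mu)$, $p\ge 1$ and a $\mu$-measurable function $g:Z\to\mathbb{R}$, the weak-$L^p$ (Marcinkiewicz) norm, raised to the power $p$, is $$[g]^p_{L^p_w(Z,\mu)}=\sup_{\lambda>0}\lambda^p\,\mu(\{z\in Z:\ |g(z)|\ge\lambda\}).$$ Here it is used with $Z=X\times X$ and $\mu=\nu\otimes\nu$.
   Formalization: The limit AVR_f is assumed to exist with the same value at every x_0, not just at some x_0: for exponentially growing f (e.g. a metric tree with one degree-4 vertex, the others of degree 3) the value depends on x_0 and the stated limit with constant c_3 fails. *)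

(* Defs.v *)
From HB Require Import structures.
From mathcomp Require Import all_boot all_order all_algebra.
From mathcomp Require Import all_classical all_reals all_analysis.

Set Implicit Arguments.
Unset Strict Implicit.
Unset Printing Implicit Defensive.

Import Order.TTheory GRing.Theory Num.Theory.
Import numFieldNormedType.Exports.

Local Open Scope classical_set_scope.
Local Open Scope ring_scope.

(* [Complete] includes [Pointed], which is harmless for a space carrying a
   nonzero measure. *)
#[short(type="completeMetricType")]
HB.structure Definition CompleteMetric (K : numDomainType) :=
  {T of Metric K T & Complete T}.

Definition borel (T : ptopologicalType) := g_sigma_algebraType (@open T).

HB.instance Definition _ (T : ptopologicalType) := Measurable.on (borel T).

Definition separable (T : topologicalType) :=
  exists D : set T, countable D /\ dense D.

Definition metric_measure_space (R : realType) (X : completeMetricType R)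
    (nu : {measure set (borel X) -> \bar R}) :=
  [/\ separable X,
      nu setT != 0%E &
      forall A : set (borel X), measurable A ->
        (exists (x : X) (r : R), A `<=` ball x r) -> (nu A < +oo)%E].

Definition upper_Ahlfors_regular (R : realType) (X : completeMetricType R)
    (nu : {measure set (borel X) -> \bar R}) (f : R -> R) (C : R) :=
  forall (x : X) (r : R), 0 < r -> (nu (ball x r) <= (C * f r)%:E)%E.

(* The value is required to be the same at every base point. When [f] grows
   exponentially, the limit at one base point does not determine it elsewhere. *)
Definition has_AVR (R : realType) (X : completeMetricType R)
    (nu : {measure set (borel X) -> \bar R}) (f : R -> R) (a : R) :=
  forall x0 : X, (nu (ball x0 r) * ((f r)^-1)%:E)%E @[r --> +oo] --> a%:E.

(* The [p]-th power of the weak-L^p norm. The measure is a bare set function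
   because the library makes the product of two measures a measure only once
   the second one is known to be sigma-finite. *)
Definition weak_Lp_norm_pow (R : realType) (d : measure_display)
    (Z : measurableType d) (mu : set Z -> \bar R) (p : R) (g : Z -> R) :
    \bar R :=
  ereal_sup [set ((l `^ p)%:E * mu [set z | (l <= `|g z|)%R])%E
            | l in [set l : R | 0 < l]].

(* With [f 0 = 0], this is 0 on the diagonal, as [0^-1 = 0]. *)
Definition quotient_fun (R : realType) (X : completeMetricType R)
    (f : R -> R) (p : R) (u : X -> R) (z : X * X) : R :=
  (u z.1 - u z.2) / (f (mdist z.1 z.2) `^ p^-1).

Definition level_set (R : realType) (X : completeMetricType R)
    (f : R -> R) (p : R) (u : X -> R) (l : R) : set (X * X) :=
  [set z | l <= `|u z.1 - u z.2| / (f (mdist z.1 z.2) `^ p^-1)].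

(* Main.v *)
(* By Tonelli and symmetry, the level set E_l is the union of its part where
   |u y| <= |u x| and of the mirror image of its part where |u y| < |u x|, so
   it suffices to treat such a half. There |u x - u y| <= 2 |u x|, so the
   section at x lies in {y | f (d(x, y)) <= (2 |u x| / l)^p}. By convexity [f] is
   an increasing bijection of the half-line, so this sublevel set is a closed
   ball, of the same measure as the open ball by continuity of r |-> nu (B(x, r)),
   and Ahlfors regularity bounds l^p times its measure by C 2^p |u x|^p.
   Integrating gives the upper bound. This bound is an integrable majorant
   independent of l. For fixed x, discarding the set {|u| >= d}, whose measure is
   finite, squeezes the section between sublevel sets at heights
   ((|u x| -+ d) / l)^p, so l^p times its measure tends to AVR |u x|^p as l -> 0.
   Dominated convergence then gives the limit, hence the lower bound. *)
Require Import Defs.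
From HB Require Import structures.
From mathcomp Require Import all_boot all_order all_algebra.
From mathcomp Require Import all_classical all_reals all_analysis.
From mathcomp Require Import measurable_realfun ring lra.

Set Implicit Arguments.
Unset Strict Implicit.
Unset Printing Implicit Defensive.

Import Order.TTheory GRing.Theory Num.Theory.
Import numFieldNormedType.Exports.

Local Open Scope classical_set_scope.
Local Open Scope ring_scope.

(** * Convex gauges on the half-line: monotonicity, continuity, surjectivity *)

Section convex_gauge.
Variables (R : realType) (f : R -> R).
Hypothesis f_ge0 : forall r : R, 0 <= r -> 0 <= f r.
Hypothesis f_convex : convex_function (`[0, +oo[%classic : set R) f.
Hypothesis f0 : f 0 = 0.

Lemma gauge_conv (x y t : R) : 0 <= x -> 0 <= y -> 0 <= t <= 1 ->
  f (t * x + (1 - t) * y) <= t * f x + (1 - t) * f y.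
Proof.
move=> x0 y0 /andP[t0 t1].
have xD : (x : R) \in (`[0, +oo[%classic : set R).
  by rewrite inE/= in_itv/= x0.
have yD : (y : R) \in (`[0, +oo[%classic : set R).
  by rewrite inE/= in_itv/= y0.
by have := f_convex (Itv01 t0 t1) xD yD.
Qed.

(** Convexity between [y] and [0] with weight [x / y], using [f 0 = 0]. This is monotonicity of the
    slope [f r / r], written without division so that [0] is allowed. *)
Lemma gauge_star (x y : R) : 0 <= x -> x <= y -> y * f x <= x * f y.
Proof.
move=> x0 xy; have y0 : 0 <= y by exact: le_trans xy.
have [->|yn0] := eqVneq y 0; first by rewrite f0 mul0r mulr0.
have yp : 0 < y by rewrite lt_neqAle eq_sym yn0.
have := @gauge_conv y 0 (x / y) y0 (lexx 0).
rewrite divr_ge0// ler_pdivrMr// mul1r xy => /(_ isT).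
rewrite f0 !mulr0 !addr0 divfK// => h.
by rewrite mulrC -ler_pdivlMr// mulrAC.
Qed.

(** Chain [y * f x <= x * f y <= y * f y], by [gauge_star] and nonnegativity of [f], then cancel
    [y]. *)
Lemma gauge_homo (x y : R) : 0 <= x -> x <= y -> f x <= f y.
Proof.
move=> x0 xy; have y0 : 0 <= y by exact: le_trans xy.
have [yE|yn0] := eqVneq y 0.
  by have -> : x = y by apply/eqP; rewrite eq_le xy yE x0.
have yp : 0 < y by rewrite lt_neqAle eq_sym yn0.
rewrite -(ler_pM2l yp) (le_trans (gauge_star x0 xy))//.
by rewrite ler_wpM2r// f_ge0.
Qed.

(* Convexity on [x, M + 1], where [f] lies between [0] and [f (M + 1)]. The
   bound reaches up to [x = 0], so continuity holds at the endpoint too. *)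
Lemma gauge_lipschitz (M x y : R) : 0 <= x -> x <= y -> y <= M ->
  f y - f x <= f (M + 1) * (y - x).
Proof.
move=> x0 xy yM.
pose d := M + 1 - x; have d1 : 1 <= d by rewrite /d; lra.
have d0 : 0 < d by exact: lt_le_trans d1.
have q0 : 0 <= (y - x) / d by apply: divr_ge0; [rewrite subr_ge0 | exact: ltW].
have q1 : (y - x) / d <= 1 by rewrite ler_pdivrMr// mul1r /d; lra.
have x1 : 0 <= 1 - (y - x) / d <= 1 by apply/andP; split; lra.
have M1 : 0 <= M + 1 by lra.
have := gauge_conv x0 M1 x1.
have -> : (1 - (y - x) / d) * x + (1 - (1 - (y - x) / d)) * (M + 1) = y.
  by rewrite /d; field; lra.
move=> /le_trans h; rewrite lerBlDr.
apply: h; rewrite subKr mulrBl mul1r.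
have F0 : 0 <= f (M + 1) by exact: f_ge0.
have fx0 : 0 <= f x by exact: f_ge0.
have : (y - x) / d * f (M + 1) <= f (M + 1) * (y - x).
  rewrite mulrC ler_wpM2l// ler_pdivrMr// ler_peMr// subr_ge0//.
have : 0 <= (y - x) / d * f x by exact: mulr_ge0.
lra.
Qed.

Lemma gauge_continuous (M : R) : {within `[0, M], continuous f}.
Proof.
have lip x y : 0 <= x <= M -> 0 <= y <= M ->
    `|f x - f y| <= f (M + 1) * `|x - y|.
  wlog xy : x y / x <= y.
    move=> h xM yM; case: (leP x y) => [xy|/ltW yx]; first exact: h.
    by rewrite distrC (distrC x); exact: h.
  move=> /andP[x0 xM] /andP[y0 yM].
  rewrite !ler0_norm ?subr_le0 ?gauge_homo// !opprB.
  exact: gauge_lipschitz.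
apply/subspace_continuousP => x; rewrite /= in_itv/= => xM.
have F0 : 0 <= f (M + 1) by case/andP: xM => *; apply: f_ge0; lra.
apply/cvgrPdist_le => e e0.
rewrite near_withinE; near=> y; rewrite /= in_itv/= => yM.
apply: (le_trans (lip _ _ xM yM)).
(* Only [0 <= f (M + 1)] is known here; adding 1 gives a positive constant to divide by. *)
apply: (@le_trans _ _ ((f (M + 1) + 1) * `|x - y|)).
  by rewrite ler_wpM2r// lerDl.
rewrite -ler_pdivlMl; last by lra.
near: y; apply: cvgr_dist_le => //.
by rewrite mulr_gt0// invr_gt0; lra.
Unshelve. all: by end_near. Qed.

Hypothesis f_gt0 : forall r : R, 0 < r -> 0 < f r.

(** The chain of [gauge_homo] becomes strict in its second step, since [f y] is now positive. *)
Lemma gauge_lt (x y : R) : 0 <= x -> x < y -> f x < f y.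
Proof.
move=> x0 xy; have y0 : 0 < y by exact: le_lt_trans xy.
rewrite -(ltr_pM2l y0) (le_lt_trans (gauge_star x0 (ltW xy)))//.
by rewrite ltr_pM2r// f_gt0.
Qed.

Lemma gauge_le (x y : R) : 0 <= x -> 0 <= y -> (f x <= f y) = (x <= y).
Proof.
move=> x0 y0; have [xy|yx] := leP x y; first by rewrite gauge_homo.
by apply/negbTE; rewrite -ltNge gauge_lt.
Qed.

Lemma gauge_surj (t : R) : 0 < t -> exists2 r, 0 < r & f r = t.
Proof.
move=> t0; have f1 : 0 < f 1 by exact: f_gt0.
(* A convex gauge grows at least linearly beyond 1: [gauge_star] gives [f M >= M * f 1 >= t], so the
   intermediate value theorem on [0, M] reaches [t]. The summand 1 ensures [1 <= M]. *)
pose M := t / f 1 + 1.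
have M1 : 1 <= M by rewrite lerDr divr_ge0// ltW.
have tM : t <= f M.
  have := gauge_star ler01 M1; rewrite mul1r; apply: le_trans.
  by rewrite mulrDl divfK ?gt_eqF// lerDl mul1r ltW.
have M0 : 0 <= M by exact: le_trans M1.
have := IVT M0 (gauge_continuous (M := M)) (v := t).
rewrite f0 min_l ?f_ge0// max_r ?f_ge0// ltW//= => /(_ tM)[r].
rewrite in_itv/= => /andP[r0 _] frt; exists r => //.
rewrite lt_neqAle r0 andbT; apply: contraTneq t0 => r00.
by rewrite -frt -r00 f0 ltxx.
Qed.

End convex_gauge.

(** * Measurability of balls and of the distance *)

Section borel_metric.
Variables (R : realType) (X : completeMetricType R).

Lemma open_mdist_ball (x : X) (r : R) : open (ball x r).
Proof.
rewrite ballEmdist openE => y /= xyr; apply/nbhs_ballP.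
exists (r - mdist x y) => /=; first by rewrite subr_gt0.
move=> z; rewrite ballEmdist/= ltrBrDl; apply: le_lt_trans.
exact: metric_triangle.
Qed.

Lemma measurable_mdist_ball (x : X) (r : R) :
  measurable (ball x r : set (borel X)).
Proof. by apply: sub_sigma_algebra; exact: open_mdist_ball. Qed.

Lemma measurable_mdist (x : X) :
  measurable_fun [set: borel X] (fun y : borel X => mdist x y).
Proof.
apply: (measurability (@RGenInftyO.G R)) => [|/= _ [_ [r ->] <-]];
  first exact: RGenInftyO.measurableE.
rewrite setTI (_ : _ @^-1` _ = ball x r); first exact: measurable_mdist_ball.
by rewrite ballEmdist; apply/seteqP; split => y /=; rewrite in_itv.
Qed.

(** The sigma-algebra on the pairs is the product one, so openness of the sublevel sets is not
    enough by itself. Separability turns each of them into a countable union of sets described by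
    distances to a fixed point, one coordinate at a time. *)
Lemma measurable_mdist2 : separable X ->
  measurable_fun [set: borel X * borel X]
    (fun z : borel X * borel X => mdist z.1 z.2).
Proof.
move=> [D [cD dD]].
apply: (measurability (@RGenInftyO.G R)) => [|/= _ [_ [r ->] <-]];
  first exact: RGenInftyO.measurableE.
rewrite setTI.
rewrite (_ : _ @^-1` _ = \bigcup_(q in D)
    [set z : borel X * borel X | mdist q z.1 + mdist q z.2 < r]); last first.
  apply/seteqP; split => [[x y]|[x y] [q Dq]] /=; rewrite in_itv/=; last first.
    apply: le_lt_trans.
    by rewrite (metric_sym q x) metric_triangle.
  (* Half the slack: passing through [q] costs at most [2 * mdist q x], which is less than
     [r - mdist x y] when [q] is within [e] of [x]. *)
  move=> xyr; pose e := (r - mdist x y) / 2.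
  have e0 : 0 < e by rewrite divr_gt0// subr_gt0.
  have [|q [xq Dq]] := dD (ball x e) _ (open_mdist_ball x e).
    by exists x; exact: ballxx.
  exists q => //=; move: xq; rewrite ballEmdist/= => xq.
  have := metric_triangle q x y; rewrite (metric_sym q x).
  by rewrite /e in xq; lra.
rewrite bigcup_set_type; apply: countable_bigcupT_measurable => [|q].
  by rewrite (eq_countable (card_setT _)).
rewrite -[X in measurable X]setTI.
apply: measurable_fun_ltr => //; apply: measurable_funD.
  exact: measurableT_comp (measurable_mdist (val q)) measurable_fst.
exact: measurableT_comp (measurable_mdist (val q)) measurable_snd.
Qed.

End borel_metric.

(** * Invariance of the product measure under exchange of the coordinates *)

Section product_swap.
Local Open Scope ereal_scope.
Context d (T : measurableType d) (R : realType).
Variable mu : {sigma_finite_measure set T -> \bar R}.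

(** [mu \x^ mu] integrates the sections in the other order, so its value on the swapped set is that
    of [mu \x mu] on [A]; the two measures agree on rectangles, hence everywhere by uniqueness. *)
Lemma product_measure_swap (A : set (T * T)) : measurable A ->
  (mu \x mu) ((fun z => (z.2, z.1)) @^-1` A) = (mu \x mu) A.
Proof.
move=> mA.
have mS : measurable ((fun z => (z.2, z.1)) @^-1` A).
  rewrite -[X in measurable X]setTI.
  by apply: (measurable_fun_pair measurable_snd measurable_fst).
rewrite (product_measure_unique (m' := mu \x^ mu))// => B C mB mC.
exact: product_measure2E.
Qed.

End product_swap.

(** * Measure of the sublevel sets of the gauge of the distance *)

Section sublevel.
Variables (R : realType) (X : completeMetricType R).
Variables (nu : {measure set (borel X) -> \bar R}) (f : R -> R) (CfA AVRf : R).
Hypothesis hX : metric_measure_space nu.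
Hypothesis f_ge0 : forall r : R, 0 <= r -> 0 <= f r.
Hypothesis f_convex : convex_function (`[0, +oo[%classic : set R) f.
Hypothesis f0 : f 0 = 0.
Hypothesis CfA_gt0 : 0 < CfA.
Hypothesis hreg : upper_Ahlfors_regular nu f CfA.
Hypothesis hcont : forall x : X,
  {in `]0, +oo[, continuous (fun r : R => nu (ball x r))}.
Hypothesis hAVR : has_AVR nu f AVRf.

(* If [f r = 0], balls of radius [r] are null and countably many cover [X]. *)
Lemma gauge_gt0 (r : R) : 0 < r -> 0 < f r.
Proof.
move=> r0; rewrite lt_neqAle f_ge0 ?ltW// andbT; apply/negP => /eqP fr0.
have [[D [cD dD]] nuT _] := hX.
have ball0 x : nu (ball x r) = 0%E.
  by apply/eqP; rewrite -measure_le0 (le_trans (hreg x r0))// -fr0 mulr0.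
move: cD => /pfcard_geP[D0|[g]].
  have [|x [_]] := dD setT _ openT; first by exists point.
  by rewrite D0.
have : nu.-negligible [set: borel X].
  apply: (@negligibleS _ _ _ nu (\bigcup_n (ball (g n : X) r : set (borel X)))).
    move=> x _.
    have [|q [xq Dq]] := dD (ball x r) _ (open_mdist_ball x r).
      by exists x; exact: ballxx.
    have [n _ gn] := @surj _ _ _ _ g q Dq.
    by exists n => //; rewrite gn; exact: ball_sym.
  apply: negligible_bigcup => n.
  by exists (ball (g n) r); split => //; exact: measurable_mdist_ball.
by move/negligibleP => /(_ measurableT)/eqP; rewrite (negbTE nuT).
Qed.

Lemma measurable_closed_mdist_ball (x : X) (r : R) :
  measurable ([set y | mdist x y <= r] : set (borel X)).
Proof.
rewrite -[X in measurable X]setTI.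
by apply: measurable_fun_ler => //; exact: measurable_mdist.
Qed.

(** The closed ball lies in every open ball of radius [s > r], and the measures of these tend to
    that of the open ball of radius [r] as [s] decreases to [r]. *)
Lemma measure_closed_mdist_ball (x : X) (r : R) : 0 < r ->
  nu [set y | mdist x y <= r] = nu (ball x r).
Proof.
move=> r0; apply/eqP; rewrite eq_le; apply/andP; split; last first.
  apply: le_measure; rewrite ?inE.
  - exact: measurable_mdist_ball.
  - exact: measurable_closed_mdist_ball.
  - by rewrite ballEmdist => y /= /ltW.
have rr : r \in `]0, +oo[ by rewrite in_itv/= r0.
have /(cvg_at_right_filter (x := r)) h := @hcont x r rr.
apply: (cvge_ge _ h).
near=> s; apply: le_measure; rewrite ?inE.
- exact: measurable_closed_mdist_ball.
- exact: measurable_mdist_ball.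
- rewrite ballEmdist => y /= /le_lt_trans; apply.
  by near: s; exact: nbhs_right_gt.
Unshelve. all: by end_near. Qed.

(** Balls indexed by the height of [f] instead of the radius: this is the form in which membership
    in the level set constrains the distance. *)
Definition gauge_ball (x : X) (t : R) : set (borel X) :=
  [set y | f (mdist x y) <= t].

Lemma gauge_ballE (x : X) (t : R) : 0 < t ->
  exists r, [/\ 0 < r, f r = t & nu (gauge_ball x t) = nu (ball x r)].
Proof.
move=> t0; have [r r0 frt] := gauge_surj f_ge0 f_convex f0 gauge_gt0 t0.
exists r; split => //; rewrite -measure_closed_mdist_ball//; congr (nu _).
apply/seteqP; split => y; rewrite /gauge_ball/= -frt;
  by rewrite (gauge_le f_ge0 f_convex f0 gauge_gt0)// ?mdist_ge0 ?ltW.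
Qed.

Lemma gauge_ballS (x : X) (s t : R) : s <= t ->
  gauge_ball x s `<=` gauge_ball x t.
Proof. by move=> st y /= /le_trans; exact. Qed.

Lemma measurable_gauge_mdist :
  measurable_fun [set: borel X * borel X]
    (fun z : borel X * borel X => f (mdist z.1 z.2)).
Proof.
(* [f] is monotone on the half-line only; truncating its argument at 0 gives a function monotone on
   the whole line, hence measurable. *)
have -> : (fun z : borel X * borel X => f (mdist z.1 z.2)) =
    (fun r => f (Num.max 0 r)) \o
    (fun z : borel X * borel X => mdist z.1 z.2).
  by apply/funext => z /=; rewrite max_r ?mdist_ge0.
apply: measurableT_comp; last by apply: measurable_mdist2; case: hX.
apply: nondecreasing_measurable => // r s rs.
apply: (gauge_homo f_ge0 f_convex f0); first by rewrite le_max lexx.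
by rewrite ge_max !le_max lexx rs orbT.
Qed.

Lemma measurable_gauge_ball (x : X) (t : R) : measurable (gauge_ball x t).
Proof.
pose A : set (borel X * borel X) := [set z | f (mdist z.1 z.2) <= t].
have := @measurable_xsection _ _ (borel X) (borel X) A x.
rewrite (_ : xsection _ _ = gauge_ball x t).
  apply; rewrite -[X in measurable X]setTI.
  by apply: measurable_fun_ler => //; exact: measurable_gauge_mdist.
by apply/seteqP; split => y; rewrite /xsection/= inE.
Qed.

Lemma gauge_ball_le (x : X) (t : R) : 0 <= t ->
  (nu (gauge_ball x t) <= (CfA * t)%:E)%E.
Proof.
(* The height [t] may be 0, where [gauge_ballE] does not apply; raising it by [e / CfA] makes it
   positive and costs exactly [e] in the bound. *)
move=> t0; apply/lee_addgt0Pr => e e0.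
have te0 : 0 < t + e / CfA by rewrite ltr_wpDl// divr_gt0.
have [r [r0 fr nur]] := gauge_ballE x te0.
apply: (@le_trans _ _ (nu (gauge_ball x (t + e / CfA)))).
  apply: le_measure; rewrite ?inE; [exact: measurable_gauge_ball..|].
  by apply: gauge_ballS; rewrite lerDl divr_ge0// ltW.
rewrite nur (le_trans (hreg x r0))// fr -EFinD lee_fin mulrDr.
by rewrite mulrCA divff ?gt_eqF// mulr1.
Qed.

Lemma gauge_ball_fin_num (x : X) (t : R) : 0 <= t ->
  nu (gauge_ball x t) \is a fin_num.
Proof.
move=> t0; rewrite ge0_fin_numE//.
by apply: le_lt_trans (gauge_ball_le x t0) _; rewrite ltry.
Qed.

Lemma gauge_ball_cvg (x : X) :
  fine (nu (gauge_ball x t)) / t @[t --> +oo] --> AVRf.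
Proof.
have /fine_cvgP[_ /cvgrPdist_lt h] := hAVR x.
apply/cvgrPdist_lt => e /h[M [_ hM]].
(* Change of variable from the radius to the height: once [t > f M'], monotonicity forces the radius
   [r] with [f r = t] beyond [M]. The maximum keeps [M'] in the half-line. *)
pose M' := Num.max M 1.
have M'0 : 0 <= M' by rewrite le_max ler01 orbT.
near=> t.
have tM : f M' < t by near: t; apply: nbhs_pinfty_gt; exact: num_real.
have t0 : 0 < t by rewrite (le_lt_trans _ tM)// f_ge0.
have [r [r0 fr nur]] := gauge_ballE x t0.
have Mr : M < r.
  have MM' : M <= M' by rewrite le_max lexx.
  apply: (le_lt_trans MM'); rewrite ltNge; apply/negP => rM'.
  move: tM; rewrite ltNge -fr => /negP; apply.
  exact: (gauge_homo f_ge0 f_convex f0 (ltW r0)).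
have := hM r Mr; rewrite /= nur -fr fineM//.
by rewrite -nur; exact/gauge_ball_fin_num/ltW.
Unshelve. all: by end_near. Qed.

End sublevel.

(** * Level sets: sections, pointwise limits, integration *)

Section level_set.
Variables (R : realType) (X : completeMetricType R).
Variables (nu : {measure set (borel X) -> \bar R}) (f : R -> R) (CfA AVRf : R).
Hypothesis hX : metric_measure_space nu.
Hypothesis f_ge0 : forall r : R, 0 <= r -> 0 <= f r.
Hypothesis f_convex : convex_function (`[0, +oo[%classic : set R) f.
Hypothesis f0 : f 0 = 0.
Hypothesis CfA_gt0 : 0 < CfA.
Hypothesis hreg : upper_Ahlfors_regular nu f CfA.
Hypothesis hcont : forall x : X,
  {in `]0, +oo[, continuous (fun r : R => nu (ball x r))}.
Hypothesis hAVR : has_AVR nu f AVRf.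
Variables (p : R) (u : borel X -> R).
Hypothesis p_gt0 : 0 < p.
Hypothesis um : measurable_fun [set: borel X] u.
Hypothesis iu : nu.-integrable [set: borel X] (fun x => (`|u x| `^ p)%:E).

Local Notation gauge_gt0 := (gauge_gt0 hX f_ge0 hreg).

(* When [f (mdist z.1 z.2) = 0] the quotient has the junk value [0], hence the
   explicit exclusion of the diagonal. *)
Lemma level_setP (l : R) (z : X * X) : 0 < l -> level_set f p u l z <->
  0 < mdist z.1 z.2 /\ f (mdist z.1 z.2) <= (`|u z.1 - u z.2| / l) `^ p.
Proof.
move=> l0; rewrite /level_set/=.
have [d0|d0] := leP (mdist z.1 z.2) 0.
  have -> : mdist z.1 z.2 = 0 by apply/eqP; rewrite eq_le d0 mdist_ge0.
  rewrite f0 powR0 ?invr_neq0 ?gt_eqF// invr0 mulr0.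
  by split => [|[]//]; rewrite leNgt l0.
have F0 := gauge_gt0 d0.
rewrite ler_pdivlMr ?powR_gt0// mulrC -ler_pdivlMr//.
set F := f _ in F0 *; set a := _ / l.
have a0 : 0 <= a by rewrite divr_ge0// ltW.
have powRK (t : R) : 0 <= t -> (t `^ p^-1) `^ p = t.
  by move=> t0; rewrite -powRrM mulVf ?gt_eqF// powRr1.
have powRKV (t : R) : 0 <= t -> (t `^ p) `^ p^-1 = t.
  by move=> t0; rewrite -powRrM mulfV ?gt_eqF// powRr1.
split=> [Fa|[_ Fa]].
  split=> //; rewrite -(powRK F (ltW F0)).
  by apply: ge0_ler_powR => //; rewrite ?nnegrE ?powR_ge0// ltW.
rewrite -(powRKV a a0); apply: ge0_ler_powR => //; rewrite ?nnegrE ?powR_ge0//.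
  by rewrite invr_ge0 ltW.
exact: ltW.
Qed.

Lemma measurable_level_set (l : R) : 0 < l ->
  measurable (level_set f p u l : set (borel X * borel X)).
Proof.
move=> l0; have -> : level_set f p u l =
    [set z : borel X * borel X | 0 < mdist z.1 z.2] `&`
    [set z : borel X * borel X |
      f (mdist z.1 z.2) <= (`|u z.1 - u z.2| / l) `^ p].
  by apply/seteqP; split => z /(level_setP _ l0).
apply: measurableI; rewrite -[X in measurable X]setTI.
  by apply: measurable_fun_ltr => //; apply: measurable_mdist2; case: hX.
apply: measurable_fun_ler => //.
  exact: (measurable_gauge_mdist hX f_ge0 f_convex f0).
apply: (measurableT_comp (measurable_powR _)).
apply: measurable_funM => //; apply: measurableT_comp => //.
apply: measurable_funB.
  exact: measurableT_comp um measurable_fst.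
exact: measurableT_comp um measurable_snd.
Qed.

(* Together with the mirror image of the strict half ([b = false]), the
   non-strict half ([b = true]) partitions the level set. *)
Definition half_level_set (b : bool) (l : R) : set (borel X * borel X) :=
  level_set f p u l `&` [set z | `|u z.2| < `|u z.1| ?<= if b].

Lemma measurable_half_level_set (b : bool) (l : R) :
  0 < l -> measurable (half_level_set b l).
Proof.
move=> l0; apply: measurableI; first exact: measurable_level_set.
rewrite -[X in measurable X]setTI.
have m1 : measurable_fun [set: borel X * borel X] (fun z => `|u z.1|).
  apply: measurableT_comp => //.
  exact: measurableT_comp um measurable_fst.
have m2 : measurable_fun [set: borel X * borel X] (fun z => `|u z.2|).
  apply: measurableT_comp => //.
  exact: measurableT_comp um measurable_snd.
by case: b => /=; [apply: measurable_fun_ler|apply: measurable_fun_ltr].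
Qed.

Lemma half_level_set_section (b : bool) (l : R) (x : borel X) :
  0 < l -> xsection (half_level_set b l) x `<=`
           gauge_ball f x ((2 * `|u x| / l) `^ p).
Proof.
move=> l0 y; rewrite /xsection/= inE => -[/level_setP-/(_ l0)/= [_]].
move=> /le_trans + /lteifW uyx; apply; apply: ge0_ler_powR.
- exact: ltW.
- by rewrite nnegrE divr_ge0// ltW.
- by rewrite nnegrE divr_ge0// ?mulr_ge0// ltW.
- rewrite ler_pM2r ?invr_gt0// (le_trans (ler_normB _ _))//.
  by rewrite mulr_natl mulr2n lerD2l.
Qed.

Lemma measure_half_level_set_section (b : bool) (l : R) (x : borel X) :
  0 < l -> (nu (xsection (half_level_set b l) x) <=
            nu (gauge_ball f x ((2 * `|u x| / l) `^ p)))%E.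
Proof.
move=> l0; apply: le_measure; rewrite ?inE.
- by apply: measurable_xsection; exact: measurable_half_level_set.
- exact: (measurable_gauge_ball hX).
- exact: half_level_set_section.
Qed.

Lemma half_level_set_section_le (b : bool) (l : R) (x : borel X) : 0 < l ->
  ((l `^ p)%:E * nu (xsection (half_level_set b l) x) <=
    (2 `^ p * CfA * `|u x| `^ p)%:E)%E.
Proof.
move=> l0.
have t0 : 0 <= (2 * `|u x| / l) `^ p by exact: powR_ge0.
apply: (@le_trans _ _ ((l `^ p)%:E * (CfA * (2 * `|u x| / l) `^ p)%:E)%E).
  rewrite lee_wpmul2l ?lee_fin ?powR_ge0//.
  apply: le_trans (measure_half_level_set_section b x l0) _.
  exact: (gauge_ball_le hX f_ge0 f_convex f0 CfA_gt0 hreg hcont x t0).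
rewrite -EFinM lee_fin mulrCA -powRM; [|exact: ltW|].
  rewrite [l * _]mulrC divfK ?gt_eqF// powRM// mulrA [_ * CfA]mulrC lexx//.
by rewrite divr_ge0 ?mulr_ge0// ltW.
Qed.

Lemma measurable_norm_ge (d : R) : measurable [set y | d <= `|u y|].
Proof.
rewrite -[X in measurable X]setTI; apply: measurable_fun_ler => //.
exact: measurableT_comp.
Qed.

(** Markov's inequality for [|u| ^ p] at the height [d ^ p]. *)
Lemma integrable_powR_level_fin_num (d : R) : 0 < d ->
  nu [set y | d <= `|u y|] \is a fin_num.
Proof.
move=> d0; rewrite ge0_fin_numE//.
have dp0 : 0 < d `^ p by exact: powR_gt0.
have mK := measurable_norm_ge d.
have /integrableP[mg] := iu.
have := @le_integral_comp_abse _ _ _ nu _ measurableT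
  (fun x => (`|u x| `^ p)%:E) (d `^ p) id (@measurable_id _ _ _)
  (fun r r0 => r0) (fun _ _ _ _ h => h) mg dp0.
move=> /le_lt_trans /[apply]; rewrite setTI => h.
apply: (@le_lt_trans _ _ (nu [set x | (d `^ p)%:E <= `|(`|u x| `^ p)%:E|]%E)).
  apply: le_measure; rewrite ?inE//.
    rewrite -[X in measurable X]setTI.
    by apply: emeasurable_fun_c_infty => //; exact: measurableT_comp.
  move=> y /= dy; rewrite lee_fin ger0_norm ?powR_ge0//.
  by apply: ge0_ler_powR => //; rewrite ?nnegrE// ltW.
rewrite ltNge leye_eq; apply/negP => /eqP K; move: h.
by rewrite K gt0_muley// lte_fin.
Qed.

(** Substitute [t = (b / l) ^ p], which tends to infinity as [l] decreases to 0; then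
    [l ^ p = b ^ p / t], and [gauge_ball_cvg] applies. *)
Lemma gauge_ball_powR_cvg (x : X) (b : R) : 0 < b ->
  l `^ p * fine (nu (gauge_ball f x ((b / l) `^ p))) @[l --> 0^'+] -->
  AVRf * b `^ p.
Proof.
move=> b0.
have binf : (b / l) `^ p @[l --> 0^'+] --> +oo.
  have hV : l^-1 @[l --> (0:R)^'+] --> +oo.
    apply/gtr0_cvgV0.
      by near=> l; rewrite invr_gt0; near: l; exact: nbhs_right_gt.
    rewrite [X in X @ _](_ : _ = id); last by apply/funext => l; exact: invrK.
    exact: cvg_at_right_filter.
  apply/cvgryPge => A.
  (* The threshold on [1 / l] that makes [(b / l) ^ p] at least [A]; the maximum with 0 makes taking
     the [p]-th root legitimate. *)
  move/cvgryPge : hV => /(_ (Num.max A 0 `^ p^-1 / b)) hA.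
  near=> l.
  have l0 : 0 < l by near: l; exact: nbhs_right_gt.
  apply: (@le_trans _ _ (Num.max A 0)); first by rewrite le_max lexx.
  have A0 : 0 <= Num.max A 0 by rewrite le_max lexx orbT.
  rewrite -[leLHS]powRr1// -(@mulVf _ p) ?gt_eqF// powRrM.
  apply: ge0_ler_powR; [exact: ltW|by rewrite nnegrE powR_ge0|..].
    by rewrite nnegrE divr_ge0 ?ltW.
  by rewrite mulrC -ler_pdivrMr//; near: l.
have := cvg_comp _ _ binf (gauge_ball_cvg hX f_ge0 f_convex f0 CfA_gt0 hreg hcont hAVR x).
move=> /(cvgMr_tmp (b := b `^ p)).
move=> h; apply: cvg_trans h; apply: near_eq_cvg; near=> l.
have l0 : 0 < l by near: l; exact: nbhs_right_gt.
have bp0 : b `^ p != 0 by rewrite gt_eqF// powR_gt0.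
have lp0 : l `^ p != 0 by rewrite gt_eqF// powR_gt0.
have blE : (b / l) `^ p = b `^ p / l `^ p.
  apply: (mulIf lp0); rewrite divfK// -powRM; [|exact/ltW/divr_gt0|exact: ltW].
  by rewrite divfK// gt_eqF.
by rewrite /= !blE; field; rewrite bp0 lp0.
Unshelve. all: by end_near. Qed.


Lemma half_level_set_section_fin_num (b : bool) (l : R) (x : borel X) :
  0 < l -> nu (xsection (half_level_set b l) x) \is a fin_num.
Proof.
move=> l0; rewrite ge0_fin_numE//.
apply: (le_lt_trans (measure_half_level_set_section b x l0)).
rewrite -ge0_fin_numE//; apply: gauge_ball_fin_num CfA_gt0 hreg hcont _ _ _ => //.
exact: powR_ge0.
Qed.

Lemma half_level_set_section_upper (b : bool) (l d : R) (x : borel X) :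
  0 < l -> 0 < d ->
  fine (nu (xsection (half_level_set b l) x)) <=
    fine (nu (gauge_ball f x (((`|u x| + d) / l) `^ p))) +
    fine (nu [set y | d <= `|u y|]).
Proof.
move=> l0 d0.
have t0 : 0 <= ((`|u x| + d) / l) `^ p by exact: powR_ge0.
have finB := gauge_ball_fin_num hX f_ge0 f_convex f0 CfA_gt0 hreg hcont x t0.
have finK := integrable_powR_level_fin_num d0.
have mB := measurable_gauge_ball hX f_ge0 f_convex f0 x
  (((`|u x| + d) / l) `^ p).
have mK := measurable_norm_ge d.
rewrite -lee_fin EFinD !fineK ?half_level_set_section_fin_num//.
apply: (le_trans _ (measureU2 nu mB mK)); apply: le_measure; rewrite ?inE.
- by apply: measurable_xsection; exact: measurable_half_level_set.
- exact: measurableU.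
move=> y; rewrite /xsection/= inE => -[/level_setP-/(_ l0)/= [_ fd] _].
have [dy|yd] := leP d `|u y|; [by right|left].
apply: (le_trans fd); apply: ge0_ler_powR.
- exact: ltW.
- by rewrite nnegrE divr_ge0// ltW.
- by rewrite nnegrE divr_ge0 ?addr_ge0// ltW.
- rewrite ler_pM2r ?invr_gt0// (le_trans (ler_normB _ _))//.
  by rewrite lerD2l ltW.
Qed.

Lemma half_level_set_section_lower (b : bool) (l d : R) (x : borel X) :
  0 < l -> 0 < d -> d < `|u x| ->
  fine (nu (gauge_ball f x (((`|u x| - d) / l) `^ p))) <=
    fine (nu (xsection (half_level_set b l) x)) +
    fine (nu [set y | d <= `|u y|]).
Proof.
move=> l0 d0 dx.
have t0 : 0 <= ((`|u x| - d) / l) `^ p by exact: powR_ge0.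
have finB := gauge_ball_fin_num hX f_ge0 f_convex f0 CfA_gt0 hreg hcont x t0.
have finK := integrable_powR_level_fin_num d0.
have mB := measurable_gauge_ball hX f_ge0 f_convex f0 x.
have mK := measurable_norm_ge d.
have mS : measurable (xsection (half_level_set b l) x).
  by apply: measurable_xsection; exact: measurable_half_level_set.
(* The gauge ball contains its centre, which the level set excludes. The height-zero ball absorbs
   this exception and is null, so adding it to the cover is free. *)
have B0 : nu (gauge_ball f x 0) = 0%E.
  apply/eqP; rewrite -measure_le0.
  have := gauge_ball_le hX f_ge0 f_convex f0 CfA_gt0 hreg hcont x (lexx 0).
  by rewrite mulr0.
rewrite -lee_fin EFinD !fineK ?half_level_set_section_fin_num//.
rewrite -[leRHS]adde0 -B0.
apply: (le_trans _ (leeD2r _ (measureU2 nu mS mK))).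
apply: (le_trans _ (measureU2 nu _ (mB 0))); last exact: measurableU.
apply: le_measure; rewrite ?inE; [exact: mB| |].
  by apply: measurableU; [exact: measurableU|exact: mB].
move=> y yB; have [dy|yd] := leP d `|u y|; first by left; right.
have [fy|fy] := leP (f (mdist x y)) 0; first by right.
(* Here [|u y| < d < |u x|] strictly, so [y] satisfies the comparison defining either half, whatever
   [b] is. *)
left; left; rewrite /xsection/= inE; split; last exact/lteifS/(lt_trans yd).
apply/level_setP => //=; split.
  rewrite lt_neqAle mdist_ge0 andbT; apply: contraTneq fy => <-.
  by rewrite f0 ltxx.
apply: (le_trans yB); apply: ge0_ler_powR.
- exact: ltW.
- by rewrite nnegrE divr_ge0 ?subr_ge0// ltW.
- by rewrite nnegrE divr_ge0// ltW.
- rewrite ler_pM2r ?invr_gt0// (le_trans _ (lerB_dist _ _))//.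
  by rewrite lerB// ltW.
Qed.

Lemma half_level_set_cvg (b : bool) (x : borel X) :
  ((l `^ p)%:E * nu (xsection (half_level_set b l) x))%E @[l --> 0^'+] -->
  (AVRf * `|u x| `^ p)%:E.
Proof.
pose N l := fine (nu (xsection (half_level_set b l) x)).
suff hN : l `^ p * N l @[l --> 0^'+] --> AVRf * `|u x| `^ p.
  apply/fine_cvgP; split.
    near=> l; have l0 : 0 < l by near: l; exact: nbhs_right_gt.
    by rewrite fin_numM// half_level_set_section_fin_num.
  apply: cvg_trans hN; apply: near_eq_cvg; near=> l.
  have l0 : 0 < l by near: l; exact: nbhs_right_gt.
  by rewrite /= fineM// half_level_set_section_fin_num.
(* The squeeze below needs some [d] with [0 < d < |u x|]. When [u x = 0], the uniform bound already
   forces the section to be null. *)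
have [u0|u0] := leP `|u x| 0.
  have ux0 : `|u x| = 0 by apply/eqP; rewrite eq_le u0 normr_ge0.
  rewrite ux0 powR0 ?gt_eqF// mulr0.
  apply: cvg_near_cst; near=> l.
  have l0 : 0 < l by near: l; exact: nbhs_right_gt.
  apply/eqP; rewrite eq_le mulr_ge0 ?powR_ge0 ?fine_ge0// andbT.
  have := half_level_set_section_le b x l0.
  rewrite -(fineK (half_level_set_section_fin_num b x l0)) -EFinM lee_fin.
  by rewrite ux0 powR0 ?gt_eqF// mulr0.
pose K d := fine (nu [set y | d <= `|u y|]).
have Kcvg d : l `^ p * K d @[l --> 0^'+] --> 0.
  by rewrite -[X in _ --> X](mul0r (K d)); apply: cvgMr_tmp; exact: powR_cvg0.
apply/cvgrPdist_lt => e e0.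
have gcvg : AVRf * c `^ p @[c --> `|u x|] --> AVRf * `|u x| `^ p.
  have : {for `|u x|, continuous (@powR R ^~ p)}.
    apply/differentiable_continuous/derivable1_diffP/derivable_powR.
    by rewrite in_itv/= u0.
  exact: cvgMl_tmp.
move/cvgrPdist_lt : gcvg => /(_ e e0)[r /= r0 hr].
(* Below [r], so that moving the base of the power from [|u x|] by [d] changes the limit by less
   than [e]; and below [|u x|], as the lower estimate requires. *)
pose d := Num.min (r / 2) (`|u x| / 2).
have d0 : 0 < d by rewrite lt_min !divr_gt0.
have dr : d < r by rewrite gt_min ltr_pdivrMr// ltr_pMr// ltr1n.
have dx : d < `|u x|.
  by rewrite gt_min orbC ltr_pdivrMr// ltr_pMr// ltr1n.
have hp : `|AVRf * `|u x| `^ p - AVRf * (`|u x| + d) `^ p| < e.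
  by apply: hr => /=; rewrite opprD addNKr normrN gtr0_norm.
have hm : `|AVRf * `|u x| `^ p - AVRf * (`|u x| - d) `^ p| < e.
  by apply: hr => /=; rewrite subKr gtr0_norm.
have ud0 : 0 < `|u x| + d by rewrite addr_gt0.
have udm0 : 0 < `|u x| - d by rewrite subr_gt0.
have cp : (l `^ p * fine (nu (gauge_ball f x (((`|u x| + d) / l) `^ p))) +
    l `^ p * K d : R) @[l --> 0^'+] --> AVRf * (`|u x| + d) `^ p.
  rewrite -[X in _ --> X]addr0.
  exact: (cvgD (gauge_ball_powR_cvg x ud0) (Kcvg d)).
have cm : (l `^ p * fine (nu (gauge_ball f x (((`|u x| - d) / l) `^ p))) -
    l `^ p * K d : R) @[l --> 0^'+] --> AVRf * (`|u x| - d) `^ p.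
  rewrite -[X in _ --> X]subr0.
  exact: (cvgB (gauge_ball_powR_cvg x udm0) (Kcvg d)).
have nm := cvgr_gt _ cm (AVRf * `|u x| `^ p - e).
have np := cvgr_lt _ cp (AVRf * `|u x| `^ p + e).
rewrite ltr_distlC in hm; rewrite ltr_distlC in hp.
have /andP[{}/nm nm _] := hm; have /andP[_ {}/np np] := hp.
near=> l.
have l0 : 0 < l by near: l; exact: nbhs_right_gt.
have lp0 : 0 < l `^ p by exact: powR_gt0.
have h1 := half_level_set_section_upper b x l0 d0.
have h2 := half_level_set_section_lower b l0 d0 dx.
rewrite -(ler_pM2l lp0) mulrDr -/(N l) -/(K d) in h1.
rewrite -(ler_pM2l lp0) mulrDr -/(N l) -/(K d) in h2.
rewrite distrC ltr_distl; apply/andP; split.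
  apply: (@lt_le_trans _ _
    (l `^ p * fine (nu (gauge_ball f x (((`|u x| - d) / l) `^ p))) -
     l `^ p * K d)); last by rewrite lerBlDr.
  by near: l; exact: nm.
by apply: (le_lt_trans h1); near: l; exact: np.
Unshelve. all: by end_near. Qed.

Lemma metric_measure_space_sigma_finite : sigma_finite [set: borel X] nu.
Proof.
have [_ _ fin] := hX.
exists (fun n => ball (point : X) n.+1%:R).
  apply/esym/seteqP; split => // y _.
  exists (Num.truncn (mdist (point : X) y)) => //=.
  by rewrite ballEmdist/= Num.Theory.truncnS_gt.
move=> n; split; first exact: measurable_mdist_ball.
apply: fin; first exact: measurable_mdist_ball.
by exists point, n.+1%:R.
Qed.

(** The same measure as [nu], packaged with its sigma-finiteness so that measurability of section
    measures and the properties of the product measure apply. *)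
Let nu' : {sigma_finite_measure set (borel X) -> \bar R} :=
  HB.pack_for (SigmaFiniteMeasure.type (borel X) R) (Measure.sort nu)
    (isSFinite.Build _ _ _ (Measure.sort nu)
      (sfinite_measure_sigma_finite metric_measure_space_sigma_finite))
    (isSigmaFinite.Build _ _ _ (Measure.sort nu)
      metric_measure_space_sigma_finite).

Lemma measurable_half_level_set_section (b : bool) (l : R) : 0 < l ->
  measurable_fun [set: borel X]
    (fun x => nu (xsection (half_level_set b l) x)).
Proof.
move=> l0; apply: (@measurable_fun_xsection _ _ _ _ _ nu').
exact: measurable_half_level_set.
Qed.

Lemma product_level_set (l : R) : 0 < l ->
  ((nu \x nu) (level_set f p u l) =
   (nu \x nu) (half_level_set true l) + (nu \x nu) (half_level_set false l))%E.
Proof.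
move=> l0.
have -> : level_set f p u l = half_level_set true l `|`
    (fun z : borel X * borel X => (z.2, z.1)) @^-1` half_level_set false l.
  apply/seteqP; split => [[x y] xy|[x y] [[]//|[/= yx _]]]; last first.
    by move: yx; rewrite /level_set/= metric_sym distrC.
  have [uyx|uxy] := leP `|u y| `|u x|; [by left|right].
  by split => //=; move: xy; rewrite /level_set/= metric_sym distrC.
have mF := measurable_half_level_set false l0.
have mS : measurable ((fun z : borel X * borel X => (z.2, z.1)) @^-1`
    half_level_set false l).
  rewrite -[X in measurable X]setTI.
  by apply: (measurable_fun_pair measurable_snd measurable_fst).
rewrite -[X in (_ + X)%E](product_measure_swap nu' mF).
apply: (@measureU _ _ _ (nu' \x nu')%E) => //.
  exact: measurable_half_level_set.
apply/seteqP; split => // -[x y] /= [[_ /= uyx] [_ /= uxy]].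
by move: uxy; rewrite ltNge uyx.
Qed.

Lemma product_half_level_setE (b : bool) (l : R) : 0 < l ->
  ((l `^ p)%:E * (nu \x nu) (half_level_set b l) =
   \int[nu]_x ((l `^ p)%:E * nu (xsection (half_level_set b l) x)))%E.
Proof.
move=> l0; rewrite ge0_integralZl//; first exact: measurable_half_level_set_section.
by rewrite lee_fin powR_ge0.
Qed.

Lemma measurable_powR_norm :
  measurable_fun [set: borel X] (fun x => (`|u x| `^ p)%:E).
Proof. by case/integrableP: iu. Qed.

Lemma product_half_level_set_le (b : bool) (l : R) : 0 < l ->
  ((l `^ p)%:E * (nu \x nu) (half_level_set b l) <=
   (2 `^ p * CfA)%:E * \int[nu]_x (`|u x| `^ p)%:E)%E.
Proof.
move=> l0; have c0 : 0 <= 2 `^ p * CfA by rewrite mulr_ge0 ?powR_ge0// ltW.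
rewrite product_half_level_setE// -ge0_integralZl//.
apply: ge0_le_integral => //.
- by move=> x _; rewrite mule_ge0// lee_fin powR_ge0.
- by apply: measurable_funeM; exact: measurable_half_level_set_section.
- by apply: measurable_funeM; exact: measurable_powR_norm.
- by move=> x _; exact: half_level_set_section_le.
- exact: measurable_powR_norm.
Qed.

Lemma product_half_level_set_cvg (b : bool) :
  ((l `^ p)%:E * (nu \x nu) (half_level_set b l))%E @[l --> 0^'+] -->
  (AVRf%:E * \int[nu]_x (`|u x| `^ p)%:E)%E.
Proof.
have Ifin := integrable_fin_num measurableT iu.
(* Dominated convergence concerns sequences, so the one-sided limit is tested along positive
   sequences [s] tending to 0; this criterion takes a real limit, hence the passage through
   [fine]. *)
rewrite -(fineK Ifin) -EFinM; apply/cvge_at_rightP => s [s0 scvg].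
rewrite EFinM (fineK Ifin).
have -> : (AVRf%:E * \int[nu]_x (`|u x| `^ p)%:E =
    \int[nu]_x (AVRf * `|u x| `^ p)%:E)%E.
  by rewrite -integralZl//.
pose h n x := ((s n `^ p)%:E * nu (xsection (half_level_set b (s n)) x))%E.
have mh n : measurable_fun [set: borel X] (h n).
  by apply: measurable_funeM; exact: measurable_half_level_set_section.
have mlim : measurable_fun [set: borel X]
    (fun x => (AVRf * `|u x| `^ p)%:E).
  under eq_fun do rewrite EFinM.
  by apply: measurable_funeM; exact: measurable_powR_norm.
have hlim : {ae nu, forall x, setT x ->
    h ^~ x @ \oo --> (AVRf * `|u x| `^ p)%:E}.
  apply: aeW => x _; have /cvge_at_rightP := @half_level_set_cvg b x.
  by apply.
have idom : nu.-integrable [set: borel X]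
    (fun x => (2 `^ p * CfA * `|u x| `^ p)%:E).
  under eq_fun do rewrite EFinM.
  exact: integrableZl.
have hdom : {ae nu, forall x n, setT x ->
    (`|h n x| <= (2 `^ p * CfA * `|u x| `^ p)%:E)%E}.
  apply: aeW => x n _; rewrite gee0_abs.
    exact: half_level_set_section_le.
  by rewrite mule_ge0// lee_fin powR_ge0.
have [_ _] := dominated_convergence measurableT mh mlim hlim idom hdom.
apply: cvg_trans; apply: near_eq_cvg; apply: nearW => n /=.
by rewrite product_half_level_setE.
Qed.

End level_set.

(** * Translation of the norms, and assembly of the estimates *)

Lemma Lfun_integrable_powR d (T : measurableType d) (R : realType)
    (mu : {measure set T -> \bar R}) (p : R) (u : T -> R) :
  0 < p -> u \in Lfun mu p%:E ->
  mu.-integrable [set: T] (fun x => (`|u x| `^ p)%:E).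
Proof.
move=> p0 /[dup] /sub_Lfun_mfun; rewrite inE/= => um /sub_Lfun_finLfun.
rewrite inE/= /finite_norm => fin; apply/integrableP; split.
  apply/measurable_EFinP; apply: (measurableT_comp (measurable_powR _)).
  exact: measurableT_comp.
under eq_integral => x _ do
  rewrite gee0_abs ?lee_fin ?powR_ge0// -poweR_EFin -abse_EFin.
by rewrite -(poweR_Lnorm _ (EFin \o u)) ?gt_eqF// poweR_lty.
Qed.

Lemma norm_quotient_fun (R : realType) (X : completeMetricType R)
    (f : R -> R) (p : R) (u : X -> R) (z : X * X) :
  `|quotient_fun f p u z| =
  `|u z.1 - u z.2| / f (mdist z.1 z.2) `^ p^-1.
Proof. by rewrite normrM normfV (ger0_norm (powR_ge0 _ _)). Qed.

Theorem theorem3p4 (R : realType) (X : completeMetricType R)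
    (nu : {measure set (borel X) -> \bar R}) (f : R -> R) (CfA AVRf : R)
    (hX : metric_measure_space nu)
    (hnuX : nu setT = +oo%E)
    (f_ge0 : forall r : R, 0 <= r -> 0 <= f r)
    (f_convex : convex_function (`[0, +oo[%classic : set R) f)
    (f_incr : {in `[0, +oo[ &, {homo f : r s / r <= s}})
    (f0 : f 0 = 0)
    (CfA_gt0 : 0 < CfA)
    (hreg : upper_Ahlfors_regular nu f CfA)
    (hcont : forall x : X,
      {in `]0, +oo[, continuous (fun r : R => nu (ball x r))})
    (hAVR : has_AVR nu f AVRf)
    (AVRf_gt0 : 0 < AVRf) :
  exists (c1 : R) (c2 : R -> R) (c3 : R),
    [/\ [/\ 0 < c1, forall p : R, 1 <= p -> 0 < c2 p & 0 < c3],
        [/\ c1 = 2 * AVRf,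
            forall p : R, 1 <= p -> c2 p = 2 `^ (p + 1) * CfA &
            c3 = 2 * AVRf] &
        forall (p : R) (u : borel X -> R), 1 <= p -> u \in Lfun nu p%:E ->
          [/\ (c1%:E * ('N[nu]_p%:E[EFin \o u] `^ p) <=
                 weak_Lp_norm_pow (nu \x nu) p (quotient_fun f p u))%E,
              (weak_Lp_norm_pow (nu \x nu) p (quotient_fun f p u) <=
                 (c2 p)%:E * ('N[nu]_p%:E[EFin \o u] `^ p))%E &
              ((l `^ p)%:E * (nu \x nu) (level_set f p u l))%E
                @[l --> 0^'+] -->
                (c3%:E * ('N[nu]_p%:E[EFin \o u] `^ p))%E]].
Proof.
(* The factor 2 counts the two halves of the level set: each contributes [AVRf] to the limit and at
   most [2 ^ p * CfA] to the upper bound. *)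
exists (2 * AVRf), (fun p => 2 `^ (p + 1) * CfA), (2 * AVRf).
have c0 : 0 < 2 * AVRf by rewrite mulr_gt0.
split; [split|split|] => // [p p1|p u p1 uL].
  by rewrite mulr_gt0// powR_gt0.
have p0 : 0 < p by exact: lt_le_trans p1.
have iu := Lfun_integrable_powR p0 uL.
have um : measurable_fun [set: borel X] u.
  by move: uL => /sub_Lfun_mfun; rewrite inE.
have Ifin := integrable_fin_num measurableT iu.
set I := (\int[nu]_x (`|u x| `^ p)%:E)%E in Ifin.
have -> : ('N[nu]_p%:E[EFin \o u] `^ p = I)%E.
  by rewrite poweR_Lnorm ?gt_eqF//; apply: eq_integral => x _; rewrite poweR_EFin.
have I0 : (0 <= I)%E.
  by apply: integral_ge0 => x _; rewrite lee_fin powR_ge0.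
have weakE : weak_Lp_norm_pow (nu \x nu)%E p (quotient_fun f p u) =
    ereal_sup [set ((l `^ p)%:E * (nu \x nu) (level_set f p u l))%E
              | l in [set l : R | 0 < l]].
  by rewrite /weak_Lp_norm_pow; congr ereal_sup; apply/seteqP; split => _ [l l0 <-];
    exists l => //; congr (_ * (nu \x nu) _)%E; apply/seteqP; split => z /=;
    rewrite norm_quotient_fun.
have scaledE l : 0 < l -> ((l `^ p)%:E * (nu \x nu) (level_set f p u l) =
    (l `^ p)%:E * (nu \x nu) (half_level_set f p u true l) +
    (l `^ p)%:E * (nu \x nu) (half_level_set f p u false l))%E.
  move=> l0; rewrite (product_level_set hX f_ge0 f_convex f0 hreg p0 um l0) ge0_muleDr//;
  by apply: integral_ge0.
have lim : ((l `^ p)%:E * (nu \x nu) (level_set f p u l))%E @[l --> 0^'+] -->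
    ((2 * AVRf)%:E * I)%E.
  have half b := product_half_level_set_cvg hX f_ge0 f_convex f0 CfA_gt0 hreg
    hcont hAVR p0 um iu b.
  have -> : ((2 * AVRf)%:E * I = AVRf%:E * I + AVRf%:E * I)%E.
    by rewrite -(fineK Ifin) -!EFinM -EFinD; congr EFin; ring.
  (* Limits of extended reals add only when the sum of the limits is not of the form infinity minus
     infinity; here both terms are nonnegative. *)
  have Idef : (AVRf%:E * I +? AVRf%:E * I)%E.
    by rewrite ge0_adde_def// inE mule_ge0// lee_fin ltW.
  apply: cvg_trans (cvgeD Idef (half true) (half false)).
  apply: near_eq_cvg; near=> l.
  have l0 : 0 < l by near: l; exact: nbhs_right_gt.
  by rewrite /= scaledE.
split => //.
(* Every value along the limit is one of those under the supremum, so the limit is bounded by the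
   supremum. *)
- rewrite weakE; apply: (cvge_le _ lim); near=> l.
  have l0 : 0 < l by near: l; exact: nbhs_right_gt.
  by apply: ereal_sup_ubound; exists l.
- rewrite weakE; apply: ge_ereal_sup => _ [l l0 <-].
  have -> : 2 `^ (p + 1) = 2 * 2 `^ p :> R.
    by rewrite powRD ?powRr1 1?mulrC// pnatr_eq0 implybT.
  rewrite scaledE//.
  have half b := product_half_level_set_le hX f_ge0 f_convex f0 CfA_gt0 hreg
    hcont p0 um iu b l0.
  apply: (le_trans (leeD (half true) (half false))).
  rewrite -/I -(fineK Ifin) -!EFinM -EFinD lee_fin.
  by rewrite [leLHS](_ : _ = 2 * 2 `^ p * CfA * fine I)//; ring.
Unshelve. all: by end_near. Qed.
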